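(* Suppose that either $\nu=1$ or $\mu=0$, where $\nu$ is the homogeneity degree of $f$ and $\mu$ that of $(\ell,\jmath)$. Let $d\in\mathbb{Z}_{>0}\cup\{\infty\}$, $x\in\mathbb{R}^{n_x}$, and let $\mathbf{u}_d^{\star}$ be an optimal sequence of inputs for the cost $J_{d,1,1}$ at $x$. Then, for any $\varepsilon>0$, $$V_{d,1,1}(\lambda^{r}(\varepsilon)x)=\varepsilon^{\mu}V_{d,1,1}(x),$$ and $\Lambda^{q}_{\nu,d}(\varepsilon)\mathbf{u}_d^{\star}$ is an optimal sequence of inputs for the cost $J_{d,1,1}$ at $\lambda^{r}(\varepsilon)x$.
   Context: Notation. For $r=(r_1,\dots,r_n)$ with all $r_i>0$, the dilation map is $\lambda^r(\varepsilon)x:=(\varepsilon^{r_1}x_1,\dots,\varepsilon^{r_n}x_n)$ for $\varepsilon>0$, $x\in\mathbb{R}^n$; for a real exponent $s$, $\lambda^r(\varepsilon)^{s}:=\lambda^r(\varepsilon^{s})$. For $d\in\mathbb{Z}_{>0}\cup\{\infty\}$, a sequence of $d$ inputs is $\mathbf{u}_d=(u_0,\dots,u_{d-1})\in(\mathbb{R}^{n_u})^d$ (an infinite sequence if $d=\infty$), and for $c\in\mathbb{R}$, $\Lambda^{q}_{c,d}(\varepsilon)\mathbf{u}_d:=(\lambda^q(\varepsilon)u_0,\lambda^q(\varepsilon)^{c}u_1,\dots,\lambda^q(\varepsilon)^{c^{d-1}}u_{d-1})$, i.e. its $k$-th entry is $\lambda^q(\varepsilon)^{c^k}u_k$. System: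 $x^+=f(x,u)$ with $f=(f_1,\dots,f_{n_x}):\mathbb{R}^{n_x}\times\mathbb{R}^{n_u}\to\mathbb{R}^{n_x}$, $n_x,n_u\in\mathbb{Z}_{>0}$. $\phi(k,x,\mathbf{u}_d)$ is the solution at time $k$ (finite, $0\le k\le d$) from initial state $x$ with inputs $\mathbf{u}_d$: $\phi(0,x,\mathbf{u}_d)=x$, $\phi(k+1,x,\mathbf{u}_d)=f(\phi(k,x,\mathbf{u}_d),u_k)$. Cost: $\ell:\mathbb{R}^{n_x}\times\mathbb{R}^{n_u}\to[0,\infty]$ is the stage cost and $\jmath:\mathbb{R}^{n_x}\to[0,\infty]$ the terminal cost ($\jmath$ is the zero function when $d=\infty$). For $\gamma_1>0$, $\gamma_2\in\mathbb{R}$, $$J_{d,\gamma_1,\gamma_2}(x,\mathbf{u}_d):=\sum_{k=0}^{d-1}\gamma_1^{\gamma_2^k}\ell(\phi(k,x,\mathbf{u}_d),u_k)+\gamma_1^{\gamma_2^d}\jmath(\phi(d,x,\mathbf{u}_d))$$ (the last term being absent if $d=\infty$), and $V_{d,\gamma_1,\gamma_2}(x):=\min_{\mathbf{u}_d}J_{d,\gamma_1,\gamma_2}(x,\mathbf{u}_d)$. A sequence attaining this minimum is called an optimal sequence of inputs for $J_{d,\gamma_1,\gamma_2}$ at $x$. Standing assumptions. (1) There are $\nu>0$, $r\in\mathbb{R}_{>0}^{n_x}$, $q\in\mathbb{R}_{>0}^{n_u}$ with $f(\lambda^r(\varepsilon)x,\lambda^q(\varepsilon)u)=\lambda^r(\varepsilon)^{\nu}f(x,u)$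 (i.e. $f_i(\lambda^r(\varepsilon)x,\lambda^q(\varepsilon)u)=\varepsilon^{r_i\nu}f_i(x,u)$ for each $i$) for all $x\in\mathbb{R}^{n_x},u\in\mathbb{R}^{n_u},\varepsilon>0$. (2) There is $\mu\in\mathbb{R}$ with $\ell(\lambda^r(\varepsilon)x,\lambda^q(\varepsilon)u)=\varepsilon^{\mu}\ell(x,u)$ and $\jmath(\lambda^r(\varepsilon)x)=\varepsilon^{\mu}\jmath(x)$ for all $x,u$ and $\varepsilon>0$. (3) For all $d\in\mathbb{Z}_{>0}\cup\{\infty\}$, $\gamma_1>0$, $\gamma_2\in\mathbb{R}$, $x\in\mathbb{R}^{n_x}$, there is a $d$-length input sequence $\mathbf{u}_d^\star$ with $V_{d,\gamma_1,\gamma_2}(x)=J_{d,\gamma_1,\gamma_2}(x,\mathbf{u}_d^\star)<\infty$. *)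

(* Defs.v *)
From mathcomp Require Import all_boot all_order all_algebra.
From mathcomp Require Import all_classical all_reals all_analysis.

Set Implicit Arguments.
Unset Strict Implicit.
Unset Printing Implicit Defensive.

Import Order.TTheory GRing.Theory Num.Theory.
Import numFieldNormedType.Exports.

Local Open Scope classical_set_scope.
Local Open Scope ring_scope.
Local Open Scope ereal_scope.

(** Vectors of [R^n] are row vectors, and [R^n -> [0, +oo]] costs are
    [\bar R]-valued functions assumed nonnegative where they are used.
    Real powers are [powR] ([e `^ s]), only used with a positive base. *)

Definition dilation (R : realType) (n : nat) (r : 'rV[R]_n) (e : R)
    (x : 'rV[R]_n) : 'rV[R]_n :=
  (\row_i (e `^ r ord0 i * x ord0 i))%R.

(** [dilation_pow r e s] is [lambda^r(e)^s := lambda^r(e^s)]. *)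
Definition dilation_pow (R : realType) (n : nat) (r : 'rV[R]_n) (e s : R)
    (x : 'rV[R]_n) : 'rV[R]_n :=
  dilation r (e `^ s)%R x.

Variant horizon := FiniteHorizon of nat | InfiniteHorizon.

Definition horizon_gt0 (d : horizon) : bool :=
  if d is FiniteHorizon n then (0 < n)%N else true.

Definition time (d : horizon) : Type :=
  match d with FiniteHorizon n => 'I_n | InfiniteHorizon => nat end.

Definition time_val (d : horizon) : time d -> nat :=
  match d return time d -> nat with
  | FiniteHorizon n => fun k : 'I_n => nat_of_ord k
  | InfiniteHorizon => fun k : nat => k
  end.

Definition inputs (R : realType) (m : nat) (d : horizon) : Type :=
  time d -> 'rV[R]_m.

(** Access by a natural number; the value [0] for [k >= d] is a dummy, never
    used by [solution] at times [k <= d]. *)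
Definition input_at (R : realType) (m : nat) (d : horizon) :
    inputs R m d -> nat -> 'rV[R]_m :=
  match d return inputs R m d -> nat -> 'rV[R]_m with
  | FiniteHorizon n => fun (u : 'I_n -> 'rV[R]_m) k =>
      if insub k is Some i then u i else 0%R
  | InfiniteHorizon => fun (u : nat -> 'rV[R]_m) k => u k
  end.

(** [Lambda^q_{c,d}(e)]. *)
Definition dilation_inputs (R : realType) (m : nat) (q : 'rV[R]_m) (c : R)
    (d : horizon) (e : R) (u : inputs R m d) : inputs R m d :=
  fun k => dilation_pow q e (c ^+ time_val k)%R (u k).

Fixpoint solution (R : realType) (n m : nat)
    (f : 'rV[R]_n -> 'rV[R]_m -> 'rV[R]_n) (d : horizon)
    (k : nat) (x : 'rV[R]_n) (u : inputs R m d) : 'rV[R]_n :=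
  if k is k'.+1 then f (solution f k' x u) (input_at u k') else x.

Definition cost (R : realType) (n m : nat)
    (f : 'rV[R]_n -> 'rV[R]_m -> 'rV[R]_n)
    (l : 'rV[R]_n -> 'rV[R]_m -> \bar R) (j : 'rV[R]_n -> \bar R)
    (d : horizon) (g1 g2 : R) (x : 'rV[R]_n) (u : inputs R m d) : \bar R :=
  let stage k :=
    (g1 `^ (g2 ^+ k))%:E * l (solution f k x u) (input_at u k) in
  match d with
  | FiniteHorizon N =>
      (\sum_(0 <= k < N) stage k) +
      (g1 `^ (g2 ^+ N))%:E * j (solution f N x u)
  | InfiniteHorizon => \sum_(0 <= k <oo) stage k
  end.

(** The minimum over input sequences, written as an infimum; [optimal_inputs]
    says that it is attained. *)
Definition value (R : realType) (n m : nat)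
    (f : 'rV[R]_n -> 'rV[R]_m -> 'rV[R]_n)
    (l : 'rV[R]_n -> 'rV[R]_m -> \bar R) (j : 'rV[R]_n -> \bar R)
    (d : horizon) (g1 g2 : R) (x : 'rV[R]_n) : \bar R :=
  ereal_inf (range (fun u : inputs R m d => cost f l j g1 g2 x u)).

Definition optimal_inputs (R : realType) (n m : nat)
    (f : 'rV[R]_n -> 'rV[R]_m -> 'rV[R]_n)
    (l : 'rV[R]_n -> 'rV[R]_m -> \bar R) (j : 'rV[R]_n -> \bar R)
    (d : horizon) (g1 g2 : R) (x : 'rV[R]_n) (u : inputs R m d) : Prop :=
  value f l j d g1 g2 x = cost f l j g1 g2 x u.

(* Main.v *)
(** Dilating the state by [e] and the [k]-th input by [e `^ (c ^+ k)] dilates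
    the [k]-th state of the solution by [e `^ (c ^+ k)], so the [k]-th stage
    cost is scaled by [e `^ (c ^+ k * mu)].  When [c = 1] or [mu = 0] this
    factor is [e `^ mu] for every [k], hence the whole cost is scaled by
    [e `^ mu].  Dilating back by [e^-1] gives the converse inequality between
    the values. *)

Require Import Defs.
From mathcomp Require Import all_boot all_order all_algebra.
From mathcomp Require Import all_classical all_reals all_analysis.

Set Implicit Arguments.
Unset Strict Implicit.
Unset Printing Implicit Defensive.

Import Order.TTheory GRing.Theory Num.Theory.
Import numFieldNormedType.Exports.

Local Open Scope classical_set_scope.
Local Open Scope ring_scope.
Local Open Scope ereal_scope.

Section Dilation.
Context {R : realType}.

Lemma dilationV n (r : 'rV[R]_n) (e : R) x : (0 < e)%R ->
  dilation r e^-1 (dilation r e x) = x.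
Proof.
move=> e0; apply/rowP => i; rewrite !mxE mulrA.
rewrite -powRM ?invr_ge0 ?ltW// mulVf ?gt_eqF//.
by rewrite powR1 mul1r.
Qed.

(** No bound on [k] is required: beyond a finite horizon both sides are the dummy input [0], which
    every dilation fixes. *)
Lemma input_at_dilation m (q : 'rV[R]_m) (c e : R) d (u : inputs R m d) k :
  input_at (dilation_inputs q c e u) k =
  dilation_pow q e (c ^+ k)%R (input_at u k).
Proof.
case: d u => [N|] u //=; case: insubP => [i _ <-//|_].
by apply/rowP => i; rewrite !mxE mulr0.
Qed.

Context {n m : nat} {f : 'rV[R]_n -> 'rV[R]_m -> 'rV[R]_n} {c : R}.
Context {r : 'rV[R]_n} {q : 'rV[R]_m}.
Hypothesis f_homogeneous : forall x u (e : R), (0 < e)%R ->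
  f (dilation r e x) (dilation q e u) = dilation_pow r e c (f x u).

(** Induction on [k]: homogeneity of [f] is applied with the factor [e]^ (c ^+
    k)[, and its degree]c[raises this factor to]e [^ (c ^+ k.+1)]. *)
Lemma solution_dilation d (u : inputs R m d) x (e : R) k : (0 < e)%R ->
  solution f k (dilation r e x) (dilation_inputs q c e u) =
  dilation_pow r e (c ^+ k)%R (solution f k x u).
Proof.
move=> e0; elim: k => [|k IH] /=.
  by rewrite /dilation_pow expr0 powRr1 ?ltW.
rewrite IH input_at_dilation /dilation_pow f_homogeneous; last exact: powR_gt0.
by rewrite /dilation_pow -powRrM -exprSr.
Qed.

Context {l : 'rV[R]_n -> 'rV[R]_m -> \bar R} {j : 'rV[R]_n -> \bar R} {mu : R}.
Hypothesis l_ge0 : forall x u, 0 <= l x u.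
Hypothesis j_ge0 : forall x, 0 <= j x.
Hypothesis l_homogeneous : forall x u (e : R), (0 < e)%R ->
  l (dilation r e x) (dilation q e u) = (e `^ mu)%:E * l x u.
Hypothesis j_homogeneous : forall x (e : R), (0 < e)%R ->
  j (dilation r e x) = (e `^ mu)%:E * j x.
Hypothesis c_mu : c = 1%R \/ mu = 0%R.

Lemma cost_dilation d (g1 g2 : R) (u : inputs R m d) x (e : R) : (0 < e)%R ->
  cost f l j g1 g2 (dilation r e x) (dilation_inputs q c e u) =
  (e `^ mu)%:E * cost f l j g1 g2 x u.
Proof.
move=> e0.
(* The dichotomy on [c] and [mu] enters here: either [c ^+ k] is [1], or both powers with exponent
   [mu] equal [1]. *)
have powE k : ((e `^ (c ^+ k)) `^ mu = e `^ mu)%R.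
  by case: c_mu => ->; rewrite ?expr1n ?powRr1 ?ltW// !powRr0.
have stageE k : (g1 `^ (g2 ^+ k))%:E *
    l (solution f k (dilation r e x) (dilation_inputs q c e u))
      (input_at (dilation_inputs q c e u) k) =
    (e `^ mu)%:E *
    ((g1 `^ (g2 ^+ k))%:E * l (solution f k x u) (input_at u k)).
  rewrite solution_dilation // input_at_dilation.
  rewrite l_homogeneous; last exact: powR_gt0.
  by rewrite powE muleCA.
have stage_ge0 k :
    0 <= (g1 `^ (g2 ^+ k))%:E * l (solution f k x u) (input_at u k).
  by rewrite mule_ge0// lee_fin powR_ge0.
case: d u stageE stage_ge0 => [N|] u stageE stage_ge0 /=.
  (* Costs may be [+oo], so distributing the factor relies on nonnegativity of the terms. *)
  rewrite ge0_muleDr; last 2 first.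
  - by apply: sume_ge0 => k _.
  - by rewrite mule_ge0// lee_fin powR_ge0.
  rewrite ge0_sume_distrr//; congr (_ + _).
    by apply: eq_bigr => k _; exact: stageE.
  rewrite solution_dilation// j_homogeneous; last exact: powR_gt0.
  by rewrite powE muleCA.
rewrite -nneseriesZl//.
by apply: eq_eseriesr => k _; exact: stageE.
Qed.

(** The dilated inputs compete in the infimum. Here [u] is arbitrary, so that the bound also applies
    to the competitors at the dilated state. *)
Lemma value_dilation_le d (g1 g2 : R) (u : inputs R m d) x (e : R) :
    (0 < e)%R ->
  value f l j d g1 g2 (dilation r e x) <= (e `^ mu)%:E * cost f l j g1 g2 x u.
Proof.
move=> e0; rewrite -cost_dilation//; apply: ereal_inf_lbound.
by exists (dilation_inputs q c e u).
Qed.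

Lemma value_dilation_ge d (g1 g2 : R) x (e : R) : (0 < e)%R ->
  (e `^ mu)%:E * value f l j d g1 g2 x <= value f l j d g1 g2 (dilation r e x).
Proof.
move=> e0; apply: le_ereal_inf_tmp => _ [v _ <-].
have ei0 : (0 < e^-1)%R by rewrite invr_gt0.
have eK : (e `^ mu * e^-1 `^ mu = 1)%R.
  by rewrite -powRM ?ltW// mulfV ?gt_eqF// powR1.
rewrite -[leRHS]mul1e -eK EFinM -muleA lee_wpmul2l ?lee_fin ?powR_ge0//.
by rewrite -{1}(dilationV r x e0); exact: value_dilation_le.
Qed.

End Dilation.

Theorem corollary1 (R : realType) (nx nu : nat)
  (nx_gt0 : (0 < nx)%N) (nu_gt0 : (0 < nu)%N)
  (f : 'rV[R]_nx -> 'rV[R]_nu -> 'rV[R]_nx)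
  (l : 'rV[R]_nx -> 'rV[R]_nu -> \bar R) (j : 'rV[R]_nx -> \bar R)
  (l_ge0 : forall x u, 0 <= l x u) (j_ge0 : forall x, 0 <= j x)
  (nu_deg : R) (r : 'rV[R]_nx) (q : 'rV[R]_nu)
  (nu_deg_gt0 : (0 < nu_deg)%R)
  (r_gt0 : forall i, (0 < r ord0 i)%R) (q_gt0 : forall i, (0 < q ord0 i)%R)
  (f_homogeneous : forall x u (e : R), (0 < e)%R ->
     f (dilation r e x) (dilation q e u) = dilation_pow r e nu_deg (f x u))
  (mu : R)
  (l_homogeneous : forall x u (e : R), (0 < e)%R ->
     l (dilation r e x) (dilation q e u) = (e `^ mu)%:E * l x u)
  (j_homogeneous : forall x (e : R), (0 < e)%R ->
     j (dilation r e x) = (e `^ mu)%:E * j x)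
  (optimal_exists : forall d (g1 g2 : R) x, horizon_gt0 d -> (0 < g1)%R ->
     exists u : inputs R nu d,
       value f l j d g1 g2 x = cost f l j g1 g2 x u /\
       cost f l j g1 g2 x u < +oo)
  (nu_mu : nu_deg = 1%R \/ mu = 0%R)
  (d : horizon) (d_gt0 : horizon_gt0 d) (x : 'rV[R]_nx)
  (ustar : inputs R nu d)
  (ustar_optimal : optimal_inputs f l j 1 1 x ustar) :
  forall e : R, (0 < e)%R ->
    value f l j d 1 1 (dilation r e x) = (e `^ mu)%:E * value f l j d 1 1 x /\
    optimal_inputs f l j 1 1 (dilation r e x)
      (dilation_inputs q nu_deg e ustar).
Proof.
move=> e e0.
have valueE :
    value f l j d 1 1 (dilation r e x) = (e `^ mu)%:E * value f l j d 1 1 x.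
  apply/eqP; rewrite eq_le (value_dilation_ge f_homogeneous)// andbT.
  (* Optimality turns the value at [x] into the cost of [ustar], to which the upper bound
     applies. *)
  by rewrite ustar_optimal (value_dilation_le f_homogeneous).
split=> //; rewrite /optimal_inputs valueE ustar_optimal.
by rewrite (cost_dilation f_homogeneous l_ge0 j_ge0 l_homogeneous
  j_homogeneous).
Qed.
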